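(* Let $X$ be an $n$-premaniplex and let $\xi:\Pi(X)\to\Gamma$ be a voltage assignment such that the derived graph $X^\xi$ is a maniplex and $$\xi(\Pi^{x,y}_{[0,m]}(X))\cap\xi(\Pi^{x,y}_{[k,n-1]}(X))=\xi(\Pi^{x,y}_{[k,m]}(X))$$ for all $k,m\in\{0,\dots,n-1\}$ and all vertices $x,y$ of $X$. Then the coset poset $$\mathcal{P}(X,\xi)=\{\xi(\Pi^x(C))\tau : C\text{ is a connected component of } X_{\overline i}\text{ for some } i\in\{0,\dots,n-1\},\ x=f(C),\ \tau\in\Gamma\},$$ with the order given in the context, is an abstract $n$-polytope on which $\Gamma$ acts (by right multiplication on cosets) with symmetry type graph $X$, i.e. $\mathcal{T}(\mathcal{P}(X,\xi),\Gamma)\cong X$.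
   Context: **Polytopes.** A poset is flagged if it has a least and a greatest element and all its maximal chains (flags) have the same finite cardinality, say $n+2$; it then has an order-preserving rank function onto $\{-1,0,\dots,n\}$. Two flags are $i$-adjacent if they differ exactly in their element of rank $i$. An (abstract) $n$-polytope is a flagged poset with rank function onto $\{-1,\dots,n\}$ such that (diamond condition) for each flag $\Phi$ and each $i\in\{0,\dots,n-1\}$ there is a unique flag $\Phi^i$ that is $i$-adjacent to $\Phi$; and (strong flag connectedness) any two flags $\Phi,\Psi$ are joined by a sequence of flags, consecutive ones adjacent, all containing $\Phi\cap\Psi$. **Graphs.** Graphs may have parallel edges and semi-edges. Every edge consists of darts; a dart $d$ has an initial vertex, a terminal vertex and an inverse dart $d^{-1}$; an edge joining two different vertices (a link) consists of two mutually inverse darts, and a semi-edge consists of a single dart $d=d^{-1}$ with both ends at the same vertex. An $n$-premaniplex is a connected graph with edges coloured by $\{0,\dots,n-1\}$, all of whose edges are links or semi-edges, such that each vertex is incident to exactly one edge of each colour, and such that if $|i-j|>1$ every path of length $4$ alternating between colours $i$ and $j$ is closed. An $n$-maniplex is an $n$-regular connected simple graph (no semi-edges, no parallel edges) with a proper edge colouring with colours $\{0,\dots,n-1\}$ such that if $|i-j|>1$ the subgraph formed by edges of colours $i,j$ is a disjoint union of $4$-cycles. **Symmetry type graph.** For a polytope $\mathcal{P}$ and $G\le\Gamma(\mathcal{P})$ (automorphism group), the symmetry type graph $\mathcal{T}(\mathcal{P},G)$ has the $G$-orbits of flags as vertices; for each flag $\Phi$ and colour $i$ there is an edge of colour $i$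 joining the orbit of $\Phi$ to that of $\Phi^i$ (a semi-edge if these orbits coincide), so that each vertex has exactly one edge of each colour. Isomorphisms of premaniplexes preserve edge colours. **Voltages.** A voltage assignment $\xi:\Pi(X)\to\Gamma$ into a group $\Gamma$ is a groupoid antimorphism from the fundamental groupoid of $X$; equivalently, it assigns to each dart $d$ an element $\xi(d)\in\Gamma$ with $\xi(d^{-1})=\xi(d)^{-1}$ and is extended to paths by $\xi(d_1d_2\cdots d_k)=\xi(d_k)\cdots\xi(d_1)$ (empty paths have trivial voltage). The derived graph $X^\xi$ has vertex set $V\times\Gamma$ and dart set $D\times\Gamma$ ($V$, $D$ the vertices and darts of $X$); the dart $(d,g)$, where $d$ goes from $x$ to $y$, goes from $(x,g)$ to $(y,\xi(d)g)$, has inverse $(d^{-1},\xi(d)g)$ and has the colour of $d$. For vertices $x,y$ and a set of colours $I$, $\xi(\Pi_I^{x,y}(X))$ is the set of voltages of paths from $x$ to $y$ using only darts with colours in $I$, and $\xi(\Pi_I^x(X))=\xi(\Pi_I^{x,x}(X))$, a subgroup of $\Gamma$. $[a,b]$ denotes $\{a,a+1,\dots,b\}$ (empty if $a>b$). **The coset poset $\mathcal{P}(X,\xi)$.** Write $\overline{i}=\{0,\dots,n-1\}\setminus\{i\}$; $X_{\overline i}$ is the graph obtained from $X$ by deleting the edges of colour $i$, and $X_{\overline i}(y)$ is its connected component containing $y$. Let $f$ be a choice function assigning to every connected subgraph $C$ of $X$ a base vertex $f(C)\in C$. For a component $C$ of $X_{\overline i}$ and $x=f(C)$, $\xi(\Pi^x(C))=\xi(\Pi^x_{\overline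 i}(X))$ is the group of voltages of closed paths in $C$ based at $x$. The elements of rank $i\in\{0,\dots,n-1\}$ are the right cosets $\xi(\Pi^x_{\overline i}(X))\gamma$, $\gamma\in\Gamma$, where $x=f(C)$ and $C$ runs over the components of $X_{\overline i}$; they are regarded as formal copies, i.e. as triples consisting of $i$, $C$ and the coset, so that elements with different $i$ or different $C$ are different. For each vertex $y$ of $X$ and each $i$, fix a path $W^y_i$ inside $X_{\overline i}(y)$ from $f(X_{\overline i}(y))$ to $y$, and set $\alpha_i^y=\xi(W_i^y)$. For $i<j$, components $C$ of $X_{\overline i}$ and $C'$ of $X_{\overline j}$ with base vertices $x=f(C)$, $x'=f(C')$, and $\gamma,\gamma'\in\Gamma$, put $\xi(\Pi^x_{\overline i}(X))\gamma<\xi(\Pi^{x'}_{\overline j}(X))\gamma'$ if and only if $\alpha_i^y\,\xi(\Pi^x_{\overline i}(X))\gamma\cap\alpha_j^y\,\xi(\Pi^{x'}_{\overline j}(X))\gamma'\neq\emptyset$ for some vertex $y\in C\cap C'$. A least element (rank $-1$) and a greatest element (rank $n$) are adjoined. *)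

(* Defs.v *)
From mathcomp Require Import all_boot all_order all_algebra.
From mathcomp Require Import boolp classical_sets functions cardinality.

Set Implicit Arguments.
Unset Strict Implicit.
Unset Printing Implicit Defensive.

Local Open Scope card_scope.
Local Open Scope classical_set_scope.
Local Open Scope group_scope.

(* An edge is a pair {d, dinv d}; it is a semi-edge when [dinv d = d], and a
   link when its end-vertices differ.  No finiteness is assumed. *)
Record cgraph (n : nat) := CGraph {
  vertex : Type;
  dart : Type;
  src : dart -> vertex;
  tgt : dart -> vertex;
  dinv : dart -> dart;
  colour : dart -> 'I_n;
  dinvK : forall d, dinv (dinv d) = d;
  src_dinv : forall d, src (dinv d) = tgt d;
  colour_dinv : forall d, colour (dinv d) = colour d }.

Definition far (i j : nat) : Prop := i.+1 < j \/ j.+1 < i.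

Section Graphs.
Variables (n : nat) (X : cgraph n).
Implicit Types (x y : vertex X) (d : dart X) (p : seq (dart X)) (i j : 'I_n).

Fixpoint walk_on (A : set (dart X)) x p y : Prop :=
  if p is d :: p' then [/\ A d, src d = x & walk_on A (tgt d) p' y] else x = y.

(* Raw data; that it really is a subgraph is part of [connected_subgraph]. *)
Record subgraph := Subgraph { sverts : set (vertex X); sdarts : set (dart X) }.

Definition connected_subgraph (C : subgraph) : Prop :=
  [/\ forall d, sdarts C d -> sdarts C (dinv d) /\ sverts C (src d),
      sverts C !=set0
    & forall x y, sverts C x -> sverts C y ->
        exists p, walk_on (sdarts C) x p y].

Definition connected : Prop := connected_subgraph (Subgraph setT setT).

Definition coloured_in (I : set 'I_n) : set (dart X) := [set d | I (colour d)].

Definition component (I : set 'I_n) y : subgraph :=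
  let reach := [set z | exists p, walk_on (coloured_in I) y p z] in
  Subgraph reach [set d | coloured_in I d /\ reach (src d)].

(* The component X_{\bar i}(y). *)
Definition Xbar i y : subgraph := component [set j | j <> i] y.

Definition four_cycle (C : subgraph) : Prop :=
  exists (v : 'I_4 -> vertex X) (d : 'I_4 -> dart X),
    [/\ injective v,
        forall k, src (d k) = v k /\ tgt (d k) = v (ordS k),
        sverts C = range v
      & sdarts C = [set e | exists k, e = d k \/ e = dinv (d k)]].

Definition premaniplex : Prop :=
  [/\ connected,
      forall d, src d = tgt d -> dinv d = d,
      forall x i, exists! d, src d = x /\ colour d = i
    & forall i j, far i j -> forall x y d1 d2 d3 d4,
        [/\ colour d1 = i, colour d2 = j, colour d3 = i & colour d4 = j] ->
        walk_on setT x [:: d1; d2; d3; d4] y -> x = y].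

Definition simple_graph : Prop :=
  (forall d, src d <> tgt d) /\
  (forall d e, src d = src e -> tgt d = tgt e -> d = e).

Definition regular_graph : Prop := forall x, [set d | src d = x] #= `I_n.

Definition proper_colouring : Prop :=
  forall d e, src d = src e -> colour d = colour e -> d = e.

Definition maniplex : Prop :=
  [/\ connected, simple_graph, regular_graph, proper_colouring
    & forall i j, far i j ->
        forall x, four_cycle (component [set c | c = i \/ c = j] x)].

End Graphs.

Definition cgraph_isomorphic (n : nat) (X Y : cgraph n) : Prop :=
  exists (fV : vertex X -> vertex Y) (fD : dart X -> dart Y),
    [/\ bijective fV, bijective fD
      & forall d, [/\ src (fD d) = fV (src d), tgt (fD d) = fV (tgt d),
                      fD (dinv d) = dinv (fD d) & colour (fD d) = colour d]].

Record voltage (n : nat) (X : cgraph n) (Gamma : groupType) := Voltage {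
  volt_dart :> dart X -> Gamma;
  volt_dinv : forall d, volt_dart (dinv d) = (volt_dart d)^-1 }.

Section Voltages.
Variables (n : nat) (X : cgraph n) (Gamma : groupType) (xi : voltage X Gamma).
Implicit Types (x y : vertex X) (d : dart X) (I : set 'I_n).

Fixpoint volt (p : seq (dart X)) : Gamma :=
  if p is d :: p' then volt p' * xi d else 1.

(* The set of voltages xi(Pi_I^{x,y}(X)). *)
Definition voltages I x y : set Gamma :=
  [set g | exists2 p, walk_on (coloured_in I) x p y & g = volt p].

Definition derived_dinv (e : dart X * Gamma) := (dinv e.1, xi e.1 * e.2).

Lemma derived_dinvK e : derived_dinv (derived_dinv e) = e.
Proof. by case: e => d g; rewrite /derived_dinv /= dinvK volt_dinv mulKg. Qed.

Definition derived : cgraph n := {|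
  vertex := (vertex X * Gamma)%type;
  dart := (dart X * Gamma)%type;
  src := fun e => (src e.1, e.2);
  tgt := fun e => (tgt e.1, xi e.1 * e.2);
  dinv := derived_dinv;
  colour := fun e => colour e.1;
  dinvK := derived_dinvK;
  src_dinv := fun e => congr1 (pair^~ (xi e.1 * e.2)) (src_dinv e.1);
  colour_dinv := fun e => colour_dinv e.1 |}.

End Voltages.

Section Polytopes.
Variables (n : nat) (T : Type) (le : T -> T -> Prop) (rk : T -> int).
Implicit Types (F P Q : set T).

Definition partial_order : Prop :=
  [/\ forall x, le x x,
      forall x y, le x y -> le y x -> x = y
    & forall x y z, le x y -> le y z -> le x z].

Definition flag F : Prop :=
  total_on F le /\ forall F', total_on F' le -> F `<=` F' -> F' = F.

Definition flagged : Prop :=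
  [/\ exists b, forall x, le b x,
      exists t, forall x, le x t
    & forall F, flag F -> F #= `I_(n.+2)].

Definition rank_function : Prop :=
  (forall x y, le x y -> x <> y -> (rk x < rk y)%R) /\
  range rk = [set r | (-1 <= r <= n%:Z)%R].

Definition adjacent (i : 'I_n) P Q : Prop :=
  P <> Q /\ forall x, rk x <> i%:Z%R -> (P x <-> Q x).

Definition diamond : Prop :=
  forall P (i : 'I_n), flag P -> exists! Q, flag Q /\ adjacent i P Q.

Definition strongly_flag_connected : Prop :=
  forall P Q, flag P -> flag Q ->
    exists (k : nat) (F : nat -> set T),
      [/\ F 0 = P, F k = Q,
          forall j, j <= k -> flag (F j) /\ P `&` Q `<=` F j
        & forall j, j < k -> exists i, adjacent i (F j) (F j.+1)].

(* The rank function of a flagged poset is unique; it is a parameter here so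
   that adjacency of flags can refer to it. *)
Definition polytope : Prop :=
  [/\ partial_order, flagged, rank_function, diamond
    & strongly_flag_connected].

Definition automorphism (g : T -> T) : Prop :=
  bijective g /\ forall x y, le x y <-> le (g x) (g y).

(* A right action by automorphisms that identifies [Gamma] with a group of
   automorphisms. *)
Definition automorphism_action (Gamma : groupType) (act : T -> Gamma -> T) :=
  [/\ forall x, act x 1 = x,
      forall x g h, act x (g * h) = act (act x g) h,
      forall g, automorphism (act^~ g)
    & forall g, (forall x, act x g = x) -> g = 1].

Variable G : set (T -> T).

Definition flag_orbit P : set (set T) := [set g @` P | g in G].

Definition stg_vertex : Type :=
  {O : set (set T) | exists2 P, flag P & O = flag_orbit P}.

(* (O, i, O') is a dart of colour i from O to O'.  For a group G of
   automorphisms of a polytope, O' is determined by O and i. *)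
Definition is_stg_dart (t : stg_vertex * 'I_n * stg_vertex) : Prop :=
  exists P Q, [/\ flag P, flag Q, adjacent t.1.2 P Q,
    sval t.1.1 = flag_orbit P & sval t.2 = flag_orbit Q].

Definition stg_dart : Type := {t | is_stg_dart t}.

Lemma adjacent_sym i P Q : adjacent i P Q -> adjacent i Q P.
Proof.
by move=> [PQ h]; split=> [/esym//|x xi]; split=> ?; apply/(h _ xi).
Qed.

Lemma is_stg_dart_inv t : is_stg_dart t -> is_stg_dart (t.2, t.1.2, t.1.1).
Proof.
by move=> [P [Q [fP fQ PQ OP OQ]]]; exists Q, P; split=> //; exact: adjacent_sym.
Qed.

Definition stg_dinv (d : stg_dart) : stg_dart :=
  exist _ _ (is_stg_dart_inv (svalP d)).

Lemma stg_dinvK d : stg_dinv (stg_dinv d) = d.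
Proof. by case: d => -[[O i] O'] h; apply: eq_exist. Qed.

Definition symmetry_type_graph : cgraph n := {|
  vertex := stg_vertex;
  dart := stg_dart;
  src := fun d => (sval d).1.1;
  tgt := fun d => (sval d).2;
  dinv := stg_dinv;
  colour := fun d => (sval d).1.2;
  dinvK := stg_dinvK;
  src_dinv := fun d => erefl;
  colour_dinv := fun d => erefl |}.

End Polytopes.

Section CosetPoset.
Variables (n : nat) (X : cgraph n) (Gamma : groupType) (xi : voltage X Gamma).

(* Base vertices of connected subgraphs. *)
Variable f : subgraph X -> vertex X.

(* [W y i] is the chosen path inside X_{\bar i}(y) from its base vertex to y. *)
Variable W : vertex X -> 'I_n -> seq (dart X).

Definition choice_function : Prop :=
  forall C, connected_subgraph C -> sverts C (f C).

Definition base_paths : Prop :=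
  forall y i, walk_on (sdarts (Xbar i y)) (f (Xbar i y)) (W y i) y.

Definition alpha (y : vertex X) (i : 'I_n) : Gamma := volt xi (W y i).

Definition rcoset_by (S : set Gamma) (g : Gamma) : set Gamma :=
  [set h * g | h in S].

Definition lcoset_by (g : Gamma) (S : set Gamma) : set Gamma :=
  [set g * h | h in S].

(* The group xi(Pi^x(C)), x = f(C), for a component C of X_{\bar i}. *)
Definition base_group (i : 'I_n) (C : subgraph X) : set Gamma :=
  voltages xi [set j | j <> i] (f C) (f C).

Definition is_face (i : 'I_n) (C : subgraph X) (S : set Gamma) : Prop :=
  (exists y, C = Xbar i y) /\ exists g, S = rcoset_by (base_group i C) g.

Record face := Face {
  face_rank : 'I_n;
  face_comp : subgraph X;
  face_coset : set Gamma;
  faceP : is_face face_rank face_comp face_coset }.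

Definition face_lt (a b : face) : Prop :=
  (face_rank a < face_rank b)%N /\
  exists y, [/\ sverts (face_comp a) y, sverts (face_comp b) y
    & (lcoset_by (alpha y (face_rank a)) (face_coset a) `&`
       lcoset_by (alpha y (face_rank b)) (face_coset b)) !=set0].

Inductive coset_poset := Least | Proper of face | Greatest.

Definition coset_lt (a b : coset_poset) : Prop :=
  match a, b with
  | Least, Least => False
  | Least, _ => True
  | Proper a', Proper b' => face_lt a' b'
  | Proper _, Greatest => True
  | _, _ => False
  end.

Definition coset_le (a b : coset_poset) : Prop := a = b \/ coset_lt a b.

Definition coset_rank (a : coset_poset) : int :=
  match a with
  | Least => (-1)%R
  | Proper a' => (face_rank a')%:Z%R
  | Greatest => n%:Z%R
  end.

Lemma is_face_act i C S (t : Gamma) :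
  is_face i C S -> is_face i C (rcoset_by S t).
Proof.
move=> [hC [g ->]]; split=> //; exists (g * t).
by rewrite /rcoset_by image_comp; apply: eq_imagel => h _ /=; rewrite mulgA.
Qed.

Definition face_act (a : face) (t : Gamma) : face :=
  Face (is_face_act t (faceP a)).

Definition coset_act (a : coset_poset) (t : Gamma) : coset_poset :=
  if a is Proper a' then Proper (face_act a' t) else a.

End CosetPoset.

Arguments coset_le {n X Gamma} xi f W a b.
Arguments coset_rank {n X Gamma} xi f a.
Arguments coset_act {n X Gamma} xi f a t.
Arguments symmetry_type_graph {n T} le rk G.

(* Main.v *)
Require Import Defs.
From mathcomp Require Import all_boot all_order all_algebra.
From mathcomp Require Import boolp classical_sets functions cardinality.

(* Left translation by [alpha] identifies the faces of rank [i] with the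
   components of the derived graph deprived of colour [i], and two faces of
   different ranks are comparable exactly when these components share a vertex.
   So every vertex [u] of the derived graph yields a maximal chain [flag_of u],
   made of the components containing [u].  As distant colours commute, a path
   avoiding colour [i] can be reordered to use first the colours above [i] and
   then those below it; this gives transitivity of the order and the fact that
   every chain lies in some [flag_of u].  The path intersection property, once
   extended from intervals to all sets of colours, says that [flag_of u] and
   [flag_of v] share the faces of ranks in [K] only if [u] and [v] are joined by
   a path with colours outside [K]: [K] full gives injectivity of [flag_of], [K]
   missing one rank gives the diamond condition, and general [K] gives strong
   flag connectedness.  [Gamma] permutes the flags over each vertex of [X]
   simply transitively, hence the symmetry type graph. *)

Set Implicit Arguments.
Unset Strict Implicit.
Unset Printing Implicit Defensive.

Import Order.TTheory.

Local Open Scope classical_set_scope.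

(** * Reachability under colour-indexed involutions, distant ones commuting *)

Section Links.
Variables (n : nat) (V : Type) (r : 'I_n -> V -> V).
Implicit Types (u v w : V) (i j : 'I_n) (I A : set 'I_n).

Inductive link I : V -> V -> Prop :=
| link_refl v : link I v v
| link_step v i w : I i -> link I (r i v) w -> link I v w.

Lemma link1 I i v : I i -> link I v (r i v).
Proof. by move=> Ii; apply: (link_step Ii); exact: link_refl. Qed.

Lemma link_trans I u v w : link I u v -> link I v w -> link I u w.
Proof.
by elim=> // {}u i {}v Ii _ IH /IH; exact: link_step.
Qed.

Lemma link_sub I A v w : I `<=` A -> link I v w -> link A v w.
Proof.
move=> IA; elim=> [{}v|{}v i {}w Ii _]; first exact: link_refl.
exact/link_step/IA.
Qed.

Lemma link_none I v w : (forall i, ~ I i) -> link I v w -> v = w.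
Proof. by move=> I0 [//|{}v i {}w /I0]. Qed.

Hypothesis rK : forall i, involutive (r i).

Lemma link_sym I v w : link I v w -> link I w v.
Proof.
elim=> [{}v|{}v i {}w Ii _ IH]; first exact: link_refl.
by apply: link_trans IH _; rewrite -{2}(rK i v); exact: link1.
Qed.

Lemma link_pair i v w : link [set i] v w -> w = v \/ w = r i v.
Proof.
elim=> [{}v|{}v j {}w /= -> _ [] ->]; [by left|by right|by rewrite rK; left].
Qed.

Hypothesis rC : forall i j v, far i j -> r i (r j v) = r j (r i v).

Lemma link_commute I i v w :
  (forall j, I j -> far i j) -> link I v w -> link I (r i v) (r i w).
Proof.
move=> far_i; elim=> [{}v|{}v j {}w Ij _ IH]; first exact: link_refl.
by apply: (link_step Ij); rewrite -rC //; exact: far_i.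
Qed.

(** Induction on the path. A first step of colour above [j] is moved past the whole lower part,
    since colours on opposite sides of [j] differ by at least 2 and so commute. *)
Lemma link_split I j v w : ~ I j -> link I v w ->
  exists u, link (I `&` [set k : 'I_n | k < j]%N) v u /\
            link (I `&` [set k : 'I_n | j < k]%N) u w.
Proof.
move=> Ij; elim=> [{}v|{}v i {}w Ii _ [u [vu uw]]].
  by exists v; split; exact: link_refl.
case: (ltngtP i j) => [ij|ji|/ord_inj eij]; last by rewrite eij in Ii.
  by exists u; split=> //; exact: (@link_step _ _ i).
exists (r i u); split; last by apply: (@link_step _ _ i) => //; rewrite rK.
rewrite -(rK i v); apply: link_commute vu => k [_ /= kj].
by right; exact: leq_ltn_trans ji.
Qed.

Lemma link_splitC I j v w : ~ I j -> link I v w ->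
  exists u, link (I `&` [set k : 'I_n | j < k]%N) v u /\
            link (I `&` [set k : 'I_n | k < j]%N) u w.
Proof.
move=> Ij /link_sym /(link_split Ij)[u [wu uv]].
by exists u; split; exact: link_sym.
Qed.

(** The path intersection property on the derived graph, with natural bounds and an exclusive upper
    one so that empty intervals of colours are covered. *)
Hypothesis link_interval : forall (a b : nat) v w,
  link [set c : 'I_n | c < b]%N v w -> link [set c : 'I_n | a <= c]%N v w ->
  link [set c : 'I_n | a <= c < b]%N v w.

(** Induction on [j]. If colour [j] lies in [A], the previous case applies. Otherwise the path is
    split at [j]: its lower part already has colours in [A] below [m], and the ends of its upper
    part are also joined by colours below [m], so [link_interval] applies to them. *)
Lemma link_prefix A (j m : nat) v w : (j <= m)%N ->
  link [set c : 'I_n | c < m]%N v w ->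
  link (A `|` [set c : 'I_n | j <= c]%N) v w ->
  link ((A `|` [set c : 'I_n | j <= c]%N) `&` [set c : 'I_n | c < m]%N) v w.
Proof.
move=> jm vw_m; elim: j jm => [|j IH] jm vw.
  by apply: link_sub vw_m => c /= ?; split => //; right.
have jS (c : 'I_n) : (j < c)%N -> (j <= c)%N by exact: ltnW.
case: (ltnP j n) => [jn|nj]; last first.
  apply: link_sub (IH (ltnW jm) _).
    move=> c [[Ac|/= /(leq_trans nj)]]; last by rewrite leqNgt ltn_ord.
    by split=> //; left.
  by apply: link_sub vw => c [Ac|/jS]; [left|right].
have [Aj|Aj] := pselect (A (Ordinal jn)).
  have sub : A `|` [set c : 'I_n | j <= c]%N `<=` A `|` [set c : 'I_n | j < c]%N.
    move=> c [Ac|/=]; first by left.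
    have [->|/eqP cj] := eqVneq c (Ordinal jn); first by left.
    by rewrite leq_eqVlt => /orP[/eqP jc|]; [case: cj; exact/val_inj|right].
  apply: link_sub (IH (ltnW jm) _) => [c [/sub]//|].
  by apply: link_sub vw => c [Ac|/jS]; [left|right].
have nAj : ~ (A `|` [set c : 'I_n | j < c]%N) (Ordinal jn) by case=> //=; rewrite ltnn.
have [u [vu uw]] := link_split nAj vw.
have uw_m : link [set c : 'I_n | c < m]%N u w.
  apply: link_trans vw_m; apply: link_sym; apply: link_sub vu => c [_ /= cj].
  exact: ltn_trans jm.
have uw_j : link [set c : 'I_n | j < c]%N u w by apply: link_sub uw => c [].
apply: (@link_trans _ _ u).
  by apply: link_sub vu => c [Ac /= cj]; split=> //=; exact: ltn_trans jm.
apply: link_sub (link_interval uw_m uw_j) => c /= /andP[jc cm].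
by split=> //; right.
Qed.

Hypothesis link_all : forall v w, link setT v w.

(* The path intersection property passes from intervals to arbitrary sets of
   colours: the colours missing from [A] are removed one by one, in increasing
   order. *)
Lemma link_inter A v w :
  (forall i, ~ A i -> link [set j | j <> i] v w) -> link A v w.
Proof.
move=> vw.
have {}vw m : (m <= n)%N -> link (A `|` [set c : 'I_n | m <= c]%N) v w.
  elim: m => [|m IH] mn; first by apply: link_sub (link_all v w) => c _; right.
  have {}IH := IH (ltnW mn); have jS (c : 'I_n) : (m < c)%N -> (m <= c)%N by exact: ltnW.
  have [Am|Am] := pselect (A (Ordinal mn)).
    apply: link_sub IH => c [Ac|/=]; first by left.
    have [->|/eqP cm] := eqVneq c (Ordinal mn); first by left.
    by rewrite leq_eqVlt => /orP[/eqP mc|]; [case: cm; exact/val_inj|right].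
  have nm : ~ [set j | j <> Ordinal mn] (Ordinal mn) by exact.
  have [u [vu uw]] := link_split nm (vw _ Am).
  apply: (@link_trans _ _ u); last by apply: link_sub uw => c [_ ?]; right.
  have vu_m : link [set c : 'I_n | c < m]%N v u by apply: link_sub vu => c [].
  (* The detour through [w] joins [v] to [u] without the colours already removed; [link_prefix] then
     confines this path to colours of [A] below [m]. *)
  have : link (A `|` [set c : 'I_n | m <= c]%N) v u.
    apply: link_trans IH _; apply: link_sym; apply: link_sub uw => c [_ /jS].
    by right.
  move/(link_prefix (leqnn m) vu_m); apply: link_sub => c [[|/= mc cm]]; first by left.
  by move: (leq_trans cm mc); rewrite ltnn.
by apply: link_sub (vw n (leqnn n)) => c [//|/=]; rewrite leqNgt ltn_ord.
Qed.

End Links.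

(** * Colour neighbours, and commutation from four-cycles *)

Section Neighbours.
Variables (n : nat) (X : cgraph n).
Hypothesis one_dart :
  forall (x : vertex X) i, exists! d, src d = x /\ colour d = i.
Implicit Types (x y : vertex X) (d : dart X) (i j : 'I_n).

Definition dart_at x i : dart X := sval (cid (one_dart x i)).

Definition neighbour i x : vertex X := tgt (dart_at x i).

Lemma src_dart_at x i : src (dart_at x i) = x.
Proof. by rewrite /dart_at; case: cid => d [[]]. Qed.

Lemma colour_dart_at x i : colour (dart_at x i) = i.
Proof. by rewrite /dart_at; case: cid => d [[]]. Qed.

Lemma dart_atE d : dart_at (src d) (colour d) = d.
Proof. by rewrite /dart_at; case: cid => e /= [_]; exact. Qed.

Lemma neighbour_src d : neighbour (colour d) (src d) = tgt d.
Proof. by rewrite /neighbour dart_atE. Qed.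

Lemma neighbourK i : involutive (neighbour i).
Proof.
move=> x; rewrite -{2}(src_dart_at x i) -(dinvK (dart_at x i)) src_dinv.
by rewrite -neighbour_src colour_dinv colour_dart_at src_dinv.
Qed.

Lemma walk_on_link (A : set (dart X)) I x p y :
  A `<=` coloured_in I -> walk_on A x p y -> link neighbour I x y.
Proof.
move=> AI; elim: p x => [|d p IH] x /=; first by move=> ->; exact: link_refl.
case=> /AI /= Id <- /IH; rewrite -neighbour_src; exact: link_step.
Qed.

(** At each vertex of the cycle the two colours leave in opposite directions, so they alternate
    around it, and both composites lead to the antipodal vertex. *)
Lemma neighbour_four_cycle i j x : i <> j ->
  four_cycle (component [set c | c = i \/ c = j] x) ->
  neighbour i (neighbour j x) = neighbour j (neighbour i x).
Proof.
set C := component _ x => ij [v [d [v_inj d_ends vertsC dartsC]]].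
have dart_cases k c : c = i \/ c = j ->
    dart_at (v k) c = d k \/ dart_at (v k) c = dinv (d (ord_pred k)).
  move=> ijc; have : sdarts C (dart_at (v k) c).
    split; first by rewrite /coloured_in /= colour_dart_at.
    rewrite src_dart_at; suff: sverts C (v k) by [].
    by rewrite vertsC; exists k.
  rewrite dartsC => -[l [] e]; have := src_dart_at (v k) c; rewrite e.
    by rewrite (d_ends l).1 => /v_inj ->; left.
  by rewrite src_dinv (d_ends l).2 => /v_inj <-; rewrite ordSK; right.
have step k :
    neighbour i (v k) = v (ordS k) /\ neighbour j (v k) = v (ord_pred k) \/
    neighbour j (v k) = v (ordS k) /\ neighbour i (v k) = v (ord_pred k).
  have back : tgt (dinv (d (ord_pred k))) = v (ord_pred k).
    by rewrite -src_dinv dinvK (d_ends _).1.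
  have neq : dart_at (v k) i <> dart_at (v k) j.
    by move=> /(congr1 (@colour _ _)); rewrite !colour_dart_at.
  rewrite /neighbour.
  have [ei|ei] := dart_cases k i (or_introl erefl);
    have [ej|ej] := dart_cases k j (or_intror erefl).
  - by case: neq; rewrite ei ej.
  - by left; rewrite ei ej back (d_ends k).2.
  - by right; rewrite ei ej back (d_ends k).2.
  - by case: neq; rewrite ei ej.
have [k ->] : exists k, x = v k.
  have : sverts C x by exists [::].
  by rewrite vertsC => -[k _ <-]; exists k.
have SS_pp : ordS (ordS k) = ord_pred (ord_pred k).
  by apply/val_inj; case: k => -[|[|[|[|]]]].
have S_neq_p l : ordS l <> ord_pred l :> 'I_4.
  by case: l => -[|[|[|[|]]]] // ? /(congr1 val).
(* Stated for arbitrary [a], [b] so that both orientations at [v k] are covered by exchanging the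
   colours. *)
have opposite a b :
    (forall l, neighbour a (v l) = v (ordS l) /\ neighbour b (v l) = v (ord_pred l) \/
               neighbour b (v l) = v (ordS l) /\ neighbour a (v l) = v (ord_pred l)) ->
    neighbour a (v k) = v (ordS k) -> neighbour b (v k) = v (ord_pred k) ->
    neighbour a (neighbour b (v k)) = neighbour b (neighbour a (v k)).
  move=> stepab ea eb; rewrite ea eb.
  have -> : neighbour b (v (ordS k)) = v (ordS (ordS k)).
    case: (stepab (ordS k)) => -[] // ea' _; have := neighbourK a (v k).
    by rewrite ea ea' => /v_inj; rewrite -[k in RHS]ordSK => /S_neq_p.
  rewrite SS_pp; case: (stepab (ord_pred k)) => -[] // _ eb'.
  have := neighbourK b (v k).
  by rewrite eb eb' => /v_inj; rewrite -[k in RHS]ord_predK => /esym/S_neq_p.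
case: (step k) => -[e1 e2]; first exact: opposite.
by apply/esym/opposite => // l; case: (step l) => -[]; [right|left].
Qed.

End Neighbours.

(** * Voltages and reachability in the derived graph *)

Section CosetPoset.
Variables (n : nat) (X : cgraph n) (Gamma : groupType) (xi : voltage X Gamma).
Hypothesis one_dart :
  forall (x : vertex X) i, exists! d, src d = x /\ colour d = i.
Local Open Scope group_scope.
Implicit Types (x y z : vertex X) (g h t : Gamma) (i j : 'I_n) (I : set 'I_n).

Lemma derived_one_dart (u : vertex (derived xi)) i :
  exists! d, src d = u /\ colour d = i.
Proof.
case: u => x g; have [d [[sd cd] d_uniq]] := one_dart x i.
exists (d, g); split=> [|[e h] [[se <-] ce]]; first by split=> //=; rewrite sd.
by rewrite (d_uniq e).
Qed.

Let r := neighbour derived_one_dart.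

Lemma voltages_id I x : voltages xi I x x 1.
Proof. by exists [::]. Qed.

Lemma voltages_dart I d :
  I (colour d) -> voltages xi I (src d) (tgt d) (xi d).
Proof. by move=> Id; exists [:: d] => //=; rewrite mul1g. Qed.

Lemma voltages_mul I x y z g h :
  voltages xi I x y g -> voltages xi I y z h -> voltages xi I x z (h * g).
Proof.
move=> [p xpy ->] yz; elim: p x xpy => [|d p IH] x /=.
  by move=> ->; rewrite mulg1.
move=> [Id <- /IH [q tqz e]]; exists (d :: q) => //=.
by rewrite -e mulgA.
Qed.

Lemma voltages_inv I x y g : voltages xi I x y g -> voltages xi I y x g^-1.
Proof.
move=> [p xpy ->]; elim: p x xpy => [|d p IH] x /=.
  by move=> ->; rewrite invg1; exact: voltages_id.
move=> [Id <- /IH yd]; rewrite invgM; apply: (voltages_mul yd).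
have := @voltages_dart I (dinv d).
by rewrite colour_dinv src_dinv -(src_dinv (dinv d)) dinvK volt_dinv; exact.
Qed.

Lemma neighbour_derived d g : r (colour d) (src d, g) = (tgt d, xi d * g).
Proof. exact: (neighbour_src derived_one_dart ((d, g) : dart (derived xi))). Qed.

(** A path [p] of [X] lifts from [(x, g)] to a path ending at [(y, volt xi p * g)], so the voltage
    is recovered as a quotient of second coordinates. *)
Lemma link_derived I (u v : vertex X * Gamma) :
  link r I u v <-> voltages xi I u.1 v.1 (v.2 * u.2^-1).
Proof.
split.
  elim=> [{}u|{}u i {}v Ii _]; first by rewrite mulgV; exact: voltages_id.
  have [d [iE uE]] : exists d, i = colour d /\ u = (src d, u.2).
    by case: u => x g; exists (dart_at one_dart x i);
      rewrite src_dart_at colour_dart_at.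
  rewrite uE iE neighbour_derived /= => dv; rewrite iE in Ii.
  by have := voltages_mul (voltages_dart Ii) dv; rewrite invgM !mulgA mulgVK.
case: u v => [x g] [y h] /= [p xpy /(canRL (mulgVK _)) ->].
elim: p x g xpy => [|d p IH] x g /=.
  by move=> ->; rewrite mul1g; exact: link_refl.
move=> [Id <- /IH dy]; apply: (link_step Id).
by rewrite neighbour_derived -mulgA; exact: dy.
Qed.

(** * Faces as components of the derived graph without one colour *)

Variables (f : subgraph X -> vertex X) (W : vertex X -> 'I_n -> seq (dart X)).
Hypothesis W_base : base_paths f W.
Implicit Types (d e : dart X) (u v w : vertex X * Gamma) (a b c : face xi f).

Notation other i := [set j | j <> i].

Lemma Xbar_eq i x y g : voltages xi (other i) x y g -> Xbar i x = Xbar i y.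
Proof.
move=> xy.
suff e : [set z | exists p, walk_on (coloured_in (other i)) x p z] =
         [set z | exists p, walk_on (coloured_in (other i)) y p z].
  by rewrite /Xbar /component e.
by apply/seteqP; split=> z [p zp];
  [have [q zq _] := voltages_mul (voltages_inv xy) (ex_intro2 _ _ p zp erefl)
  |have [q zq _] := voltages_mul xy (ex_intro2 _ _ p zp erefl)]; exists q.
Qed.

Lemma alpha_voltages x i :
  voltages xi (other i) (f (Xbar i x)) x (alpha xi W x i).
Proof.
exists (W x i) => //; move: (W_base x i).
by elim: (W x i) (f _) => //= d p IH y [[? _] ? /IH].
Qed.

Lemma face_ext a b : face_rank a = face_rank b -> face_comp a = face_comp b ->
  face_coset a = face_coset b -> a = b.
Proof.
case: a b => [i C S aP] [j D T bP] /= ij CD ST.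
by move: bP; rewrite -ij -CD -ST => bP; rewrite (Prop_irrelevance aP bP).
Qed.

(** The representative is the one for which left translation of the coset by [alpha] gives a set
    containing [u.2]. *)
Lemma face_atP u i : is_face xi f i (Xbar i u.1)
  (rcoset_by (base_group xi f i (Xbar i u.1)) ((alpha xi W u.1 i)^-1 * u.2)).
Proof. by split; [exists u.1|exists ((alpha xi W u.1 i)^-1 * u.2)]. Qed.

(* Faces of rank [i] correspond to the components of the derived graph deprived
   of colour [i]; this is the face corresponding to the component of [u]. *)
Definition face_at u i : face xi f := Face (face_atP u i).

Lemma face_at_surj a : exists u, face_at u (face_rank a) = a.
Proof.
case: a => i C S aP; have [[y eC] [g eS]] := aP.
by exists (y, alpha xi W y i * g); apply: face_ext => //=; rewrite ?mulKg -eC.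
Qed.

Lemma link_face_at u v i : link r (other i) u v -> face_at u i = face_at v i.
Proof.
move=> /link_derived; case: u v => x g [y h] /= xy.
have eX := Xbar_eq xy; apply: face_ext => //=; rewrite -eX.
have xB := alpha_voltages x i; have yB := alpha_voltages y i; rewrite -eX in yB.
(* One inclusion of cosets, general enough to be used in both directions. The representatives differ
   by the voltage of the closed path from the base vertex to [x1], on to [y1], and back. *)
have shift g1 h1 t1 t2 x1 y1 : voltages xi (other i) x1 y1 (h1 * g1^-1) ->
    voltages xi (other i) (f (Xbar i x)) x1 t1 ->
    voltages xi (other i) (f (Xbar i x)) y1 t2 ->
    rcoset_by (base_group xi f i (Xbar i x)) (t1^-1 * g1) `<=`
    rcoset_by (base_group xi f i (Xbar i x)) (t2^-1 * h1).
  move=> xy1 xB1 yB1 _ [k Bk <-].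
  exists (k * (t2^-1 * (h1 * g1^-1 * t1))^-1); last first.
    by rewrite !invgM !invgK !mulgA mulgK mulgVK.
  apply: voltages_mul Bk; apply: voltages_inv.
  apply: voltages_mul (voltages_inv yB1); exact: voltages_mul xy1.
apply/seteqP; split; first exact: shift xB yB.
by apply: shift yB xB; rewrite -[g * _]invgK invgM invgK; exact: voltages_inv.
Qed.

(** The right-hand side is the membership condition inside [face_lt]. Conversely, a path from [v.1]
    to the base vertex, a closed path of voltage [k] there, and a path out to [u.1] place [u] and
    [v] in one component. *)
Lemma face_at_mem a u : face_at u (face_rank a) = a <->
  sverts (face_comp a) u.1 /\
  lcoset_by (alpha xi W u.1 (face_rank a)) (face_coset a) u.2.
Proof.
split=> [e|].
  rewrite -e /=; split; first by exists [::].
  exists (1 * ((alpha xi W u.1 (face_rank a))^-1 * u.2)).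
    by exists 1 => //; exact: voltages_id.
  by rewrite mul1g mulVKg.
have [v <-] := face_at_surj a; move: (face_rank a) => i /=.
case=> -[p vpu] [_ [k Bk <-] uE]; apply/esym/link_face_at/link_derived.
have vu : voltages xi (other i) v.1 u.1 (volt xi p) by exists p.
have eX := Xbar_eq vu; rewrite -uE !mulgA mulgK.
apply: voltages_mul (voltages_inv (alpha_voltages v.1 i)) _.
by apply: voltages_mul Bk _; rewrite eX; exact: alpha_voltages.
Qed.

Lemma face_atE u v i : face_at u i = face_at v i <-> link r (other i) u v.
Proof.
split=> [e|]; last exact: link_face_at.
have /(face_at_mem (face_at v i))/= [_ [_ [k Bk <-] uE]] := e.
have eX : Xbar i u.1 = Xbar i v.1 by move: e => /(congr1 (@face_comp _ _ _ _ _)).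
apply: (link_sym (neighbourK derived_one_dart)); apply/link_derived.
rewrite -uE !mulgA mulgK.
apply: voltages_mul (voltages_inv (alpha_voltages v.1 i)) _.
by apply: voltages_mul Bk _; rewrite -eX; exact: alpha_voltages.
Qed.

(** An element [g] common to the two translates at [y] is the same thing as a vertex [(y, g)] common
    to the two components. *)
Lemma face_ltP a b : face_lt W a b <-> (face_rank a < face_rank b)%N /\
  exists u, face_at u (face_rank a) = a /\ face_at u (face_rank b) = b.
Proof.
split=> -[ab]; first move=> [y [ya yb [g [ga gb]]]].
  by split=> //; exists (y, g); split; apply/face_at_mem.
move=> [u [/face_at_mem[ua ga] /face_at_mem[ub gb]]].
by split=> //; exists u.1; split=> //; exists u.2.
Qed.

(** Acting on cosets corresponds to the covering translation of the derived graph. *)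
Lemma face_act_at u i t : face_act (face_at u i) t = face_at (u.1, u.2 * t) i.
Proof.
apply: face_ext => //=; rewrite /rcoset_by image_comp.
by apply: eq_imagel => h _ /=; rewrite !mulgA.
Qed.


(** * The order, the flags and the polytope axioms *)

Hypotheses (rC : forall i j u, far i j -> r i (r j u) = r j (r i u))
  (r_neq : forall i u, r i u <> u)
  (link_all : forall u v, link r setT u v)
  (link_interval : forall (k m : nat) u v,
    link r [set c : 'I_n | c < m]%N u v -> link r [set c : 'I_n | k <= c]%N u v ->
    link r [set c : 'I_n | k <= c < m]%N u v)
  (u0 : vertex X * Gamma).

Let rK : forall i, involutive (r i) := neighbourK derived_one_dart.

(** A path from [u] to [v] avoiding [i] is reordered with the colours above [i] first; [w] is the
    turning point. Colours above [i] preserve faces of rank at most [i], and colours below [i] those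
    of rank at least [i]. *)
Lemma face_at_split i u v : face_at u i = face_at v i -> exists w,
  (forall j, (j <= i)%N -> face_at w j = face_at u j) /\
  (forall j, (i <= j)%N -> face_at w j = face_at v j).
Proof.
move=> uv; have nii : ~ other i i by exact.
have [w [uw wv]] := link_splitC rK rC nii ((face_atE _ _ _).1 uv).
exists w; split=> j ij; apply/face_atE.
  apply: (link_sym rK); apply: link_sub uw => k [_ /= ik] kj.
  by move: ik; rewrite kj ltnNge ij.
by apply: link_sub wv => k [_ /= ki] kj; move: ki; rewrite kj ltnNge ij.
Qed.

Lemma face_lt_trans a b c : face_lt W a b -> face_lt W b c -> face_lt W a c.
Proof.
move=> /face_ltP[ab [u [ua ub]]] /face_ltP[bc [v [vb vc]]].
have [w [wu wv]] : exists w,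
    (forall j, (j <= face_rank b)%N -> face_at w j = face_at u j) /\
    (forall j, (face_rank b <= j)%N -> face_at w j = face_at v j).
  by apply: face_at_split; rewrite ub vb.
apply/face_ltP; split; first exact: ltn_trans bc.
by exists w; rewrite wu ?wv ?ua ?vc // ltnW.
Qed.

Notation poset := (coset_poset xi f).
Notation le := (coset_le xi f W).
Notation rk := (coset_rank xi f).

Lemma coset_lt_rank (p q : poset) : coset_lt W p q -> (rk p < rk q)%R.
Proof.
case: p q => [|a|] [|b|] //= => [[]|]; rewrite ltz_nat // ltn_ord.
Qed.

Lemma coset_le_order : partial_order le.
Proof.
split=> [p|p q [//|/coset_lt_rank pq]|]; first by left.
  by case=> [//|/coset_lt_rank]; rewrite ltNge ltW.
move=> p q s [-> //|pq] [<-|qs]; right=> //; move: pq qs.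
by case: p q s => [|a|] [|b|] [|c|] //=; exact: face_lt_trans.
Qed.

Lemma Proper_le a b : le (Proper a) (Proper b) -> a = b \/ face_lt W a b.
Proof. by case=> [[]|]; [left|right]. Qed.

Lemma face_at_lt u i j : (i < j)%N -> face_lt W (face_at u i) (face_at u j).
Proof. by move=> ij; apply/face_ltP; split=> //; exists u. Qed.

Definition flag_of u : set poset :=
  [set p | if p is Proper a then face_at u (face_rank a) = a else True].

Lemma flag_of_total u : total_on (flag_of u) le.
Proof.
move=> [|a|] [|b|] //= ua ub; try (by left; left); try (by left; right);
  try by right; right.
rewrite -ua -ub; case: (ltngtP (face_rank a) (face_rank b)) => [ab|ba|/ord_inj->].
- by left; right; exact: face_at_lt.
- by right; right; exact: face_at_lt.
- by left; left.
Qed.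

(** Elements of the chain are absorbed by increasing rank: from a vertex [u] lying in all those of
    rank below [m], a vertex lying also in the one of rank [m] is made. *)
Lemma chain_flag_of (F : set poset) : total_on F le ->
  exists u, F `<=` flag_of u.
Proof.
move=> F_tot; have F_rank a b : F (Proper a) -> F (Proper b) ->
    (face_rank a < face_rank b)%N -> face_lt W a b.
  move=> Fa Fb ab; case: (F_tot _ _ Fa Fb) => /Proper_le[ab'|//].
  - by rewrite ab' ltnn in ab.
  - by rewrite ab' ltnn in ab.
  - by case=> /ltn_trans/(_ ab); rewrite ltnn.
suff H m : exists u, forall a, F (Proper a) -> (face_rank a < m)%N ->
    face_at u (face_rank a) = a.
  by have [u uF] := H n; exists u => -[|a|] //= Fa; exact: uF.
elim: m => [|m [u uF]]; first by exists u0.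
have [[a Fa am]|no_a] := pselect (exists2 a, F (Proper a) & face_rank a = m :> nat);
    last first.
  exists u => a Fa; rewrite ltnS leq_eqVlt => /orP[/eqP am|]; last exact: uF.
  by case: no_a; exists a.
suff [v [va vF]] : exists v, face_at v (face_rank a) = a /\
    forall b, F (Proper b) -> (face_rank b < m)%N -> face_at v (face_rank b) = b.
  exists v => b Fb; rewrite ltnS leq_eqVlt => /orP[/eqP bm|]; last exact: vF.
  suff -> : b = a by [].
  by case: (F_tot _ _ Fa Fb) => /Proper_le[//|[]]; rewrite am bm ltnn.
(* Inner induction on [j]: some vertex lies in [a] and in every element of the chain of rank below
   [j]. *)
elim: {-2}m (leqnn m) => [|j IH] jm.
  by have [v va] := face_at_surj a; exists v.
have [[b Fb bj]|no_b] := pselect (exists2 b, F (Proper b) & face_rank b = j :> nat);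
    last first.
  have [v [va vF]] := IH (ltnW jm); exists v; split=> // b Fb.
  rewrite ltnS leq_eqVlt => /orP[/eqP bj|]; last exact: vF.
  by case: no_b; exists b.
have ba : (face_rank b < face_rank a)%N by rewrite bj am.
have /face_ltP[_ [w [wb wa]]] := F_rank _ _ Fb Fa ba.
(* Both [u] and [w] lie in [b]; splitting there keeps the faces of [u] up to rank [j] and the face
   [a] of [w]. *)
have [|v [vu vw]] := @face_at_split (face_rank b) u w.
  by rewrite wb uF // bj.
exists v; split=> [|c Fc cj]; first by rewrite vw ?wa // ltnW.
by rewrite vu ?uF //; [exact: leq_trans cj jm|rewrite bj].
Qed.

(** Each side has exactly one face of every rank, so inclusion forces equality; this yields
    maximality of these chains. *)
Lemma flag_of_sub u v : flag_of u `<=` flag_of v -> flag_of v = flag_of u.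
Proof.
move=> uv; have e i : face_at v i = face_at u i by exact: (uv (Proper (face_at u i))).
by apply/seteqP; split=> // -[|a|] //=; rewrite e.
Qed.

Lemma flag_ofP F : flag le F <-> exists u, F = flag_of u.
Proof.
split=> [[F_tot F_max]|[u ->]].
  have [u Fu] := chain_flag_of F_tot; exists u.
  by apply/esym/F_max => //; exact: flag_of_total.
split; first exact: flag_of_total.
move=> {}F F_tot uF; have [v Fv] := chain_flag_of F_tot.
apply/seteqP; split=> //; rewrite -(@flag_of_sub u v) //.
exact: subset_trans Fv.
Qed.

Lemma flag_of_link A u v :
  (forall i, ~ A i -> face_at u i = face_at v i) -> link r A u v.
Proof.
move=> uv; apply: (link_inter rK rC link_interval link_all) => i Ai.
exact/face_atE/uv.
Qed.

Lemma flag_of_inj : injective flag_of.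
Proof.
move=> u v uv; apply: (@link_none _ _ r set0) => [i []|].
apply: flag_of_link => i _; have : flag_of v (Proper (face_at u i)) by rewrite -uv.
by [].
Qed.

Lemma flag_of_adjacent u v i :
  adjacent rk i (flag_of u) (flag_of v) <-> v = r i u.
Proof.
split=> [[uv e]|->]; last first.
  split=> [/flag_of_inj/esym/r_neq//|[|a|] //= ai].
  suff -> : face_at (r i u) (face_rank a) = face_at u (face_rank a) by [].
  apply/face_atE; apply: (link_sym rK); apply: link1 => /= ia.
  by apply: ai; rewrite ia.
(* Agreement at all other ranks leaves only colour [i], whose involution offers just [u] and
   [r i u]. *)
have uv_i : link r [set i] u v.
  apply: flag_of_link => j /= ji; suff /e : rk (Proper (face_at v j)) <> i%:Z%R.
    by move=> /= [_]; apply.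
  by move=> /= [] /ord_inj.
by have [vu|//] := link_pair rK uv_i; case: uv; rewrite vu.
Qed.

(** The link from [u] is recorded at every stage so that faces of ranks outside [A] can be seen to
    persist along the sequence. *)
Lemma link_flag_sequence A u v : link r A u v -> exists (k : nat) (F : nat -> set poset),
  [/\ F 0%N = flag_of u, F k = flag_of v,
      forall j : nat, exists2 w, F j = flag_of w & link r A u w
    & forall j : nat, (j < k)%N -> exists i, adjacent rk i (F j) (F j.+1)].
Proof.
elim=> [{}u|{}u i {}v Ai _ [k [F [F0 Fk Fw F_adj]]]].
  by exists 0%N, (fun=> flag_of u); split=> // _; exists u => //; exact: link_refl.
exists k.+1, (fun l => if l is l'.+1 then F l' else flag_of u); split=> // [[|j]|[|j]].
- by exists u => //; exact: link_refl.
- by have [w Fj uw] := Fw j; exists w => //; exact: link_step Ai uw.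
- by move=> _; exists i; rewrite F0; exact/flag_of_adjacent.
- by rewrite ltnS => /F_adj.
Qed.

Lemma flag_of_card u : (flag_of u #= `I_(n.+2))%card.
Proof.
(* The rank shifted by one, so that it starts at 0. *)
pose h (p : poset) := match p with
  Least => 0%N | Proper a => (face_rank a).+1 | Greatest => n.+1 end.
have h_inj : {in flag_of u &, injective h}.
  move=> [|a|] [|b|] // /set_mem/= ua /set_mem/= ub [].
  - by move/ord_inj => ab; rewrite -ua ab ub.
  - by move=> an; have := ltn_ord (face_rank a); rewrite an ltnn.
  - by move=> bn; have := ltn_ord (face_rank b); rewrite -bn ltnn.
have := inj_card_eq h_inj; rewrite card_eq_sym; congr (_ #= _)%card.
apply/seteqP; split=> [k [[|a|] _ <-] //=|[|k] /=].
- by rewrite ltnS ltnW // ltnS.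
- by move=> _; exists (Least xi f).
- rewrite ltnS leq_eqVlt => /orP[/eqP[->]|kn]; first by exists (Greatest xi f).
  by exists (Proper (face_at u (Ordinal (kn : (k < n)%N)))).
Qed.

Lemma coset_rank_function : rank_function n le rk.
Proof.
split=> [p q [//|/coset_lt_rank//]|].
apply/seteqP; split=> [_ [[|a|] _ <-] //=|z /= /andP[z_ge z_le]].
- by rewrite lez_nat ltnW.
- case: z z_ge z_le => [k _|[|k] //= _ _]; last by exists (Least xi f).
  rewrite lez_nat leq_eqVlt => /orP[/eqP->|kn]; first by exists (Greatest xi f).
  by exists (Proper (face_at u0 (Ordinal kn))).
Qed.

Lemma coset_polytope : polytope n le rk.
Proof.
split.
- exact: coset_le_order.
- split; [exists (Least xi f)|exists (Greatest xi f)|by move=> F /flag_ofP[u ->]; exact: flag_of_card].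
    by move=> [|a|]; [left|right|right].
  by move=> [|a|]; [right|right|left].
- exact: coset_rank_function.
- move=> P i /flag_ofP[u ->]; exists (flag_of (r i u)); split.
    by split; [apply/flag_ofP; exists (r i u)|exact/flag_of_adjacent].
  by move=> _ [/flag_ofP[v ->] /flag_of_adjacent ->].
- move=> P Q /flag_ofP[u ->] /flag_ofP[v ->].
  have /link_flag_sequence[k [F [F0 Fk Fw F_adj]]] :
      (* Only ranks where the two flags differ serve as colours, so no step changes a common
         face. *)
      link r [set i | face_at u i <> face_at v i] u v.
    by apply: flag_of_link => i /contrapT.
  exists k, F; split=> // j _; have [w -> uw] := Fw j; split.
    by apply/flag_ofP; exists w.
  move=> [|a|] //= [ua va]; rewrite -[RHS]ua; apply/face_atE/(link_sym rK).
  by apply: link_sub uw => i /= + ia; rewrite ia ua va.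
Qed.

(** * The action of [Gamma] by automorphisms *)

Lemma face_act1 a : face_act a 1 = a.
Proof. by have [u <-] := face_at_surj a; rewrite face_act_at mulg1; case: u. Qed.

Lemma face_actM a g h : face_act a (g * h) = face_act (face_act a g) h.
Proof. by have [u <-] := face_at_surj a; rewrite !face_act_at mulgA. Qed.

Lemma face_lt_act a b g : face_lt W a b -> face_lt W (face_act a g) (face_act b g).
Proof.
move=> /face_ltP[ab [u [ua ub]]]; apply/face_ltP; split=> //.
by exists (u.1, u.2 * g); rewrite -!face_act_at ua ub.
Qed.

Notation act := (coset_act xi f).

Lemma coset_act1 p : act p 1 = p.
Proof. by case: p => //= a; rewrite face_act1. Qed.

Lemma coset_actM p g h : act p (g * h) = act (act p g) h.
Proof. by case: p => //= a; rewrite face_actM. Qed.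

Lemma coset_actK g : cancel (act^~ g) (act^~ g^-1).
Proof. by move=> p; rewrite -coset_actM mulgV coset_act1. Qed.

Lemma coset_actVK g : cancel (act^~ g^-1) (act^~ g).
Proof. by move=> p; rewrite -coset_actM mulVg coset_act1. Qed.

Lemma coset_le_act p q g : le p q -> le (act p g) (act q g).
Proof.
by case=> [->|]; [left|case: p q => [|a|] [|b|] //=; right => //; exact: face_lt_act].
Qed.

Lemma act_flag_of u g : act^~ g @` flag_of u = flag_of (u.1, u.2 * g).
Proof.
apply/seteqP; split=> [_ [[|a|] //= ua <- //=]|[|b|] //= ub].
- by rewrite -face_act_at ua.
- by exists (Least xi f).
- by exists (Proper (face_at u (face_rank b))) => //=; rewrite face_act_at ub.
- by exists (Greatest xi f).
Qed.

Lemma coset_automorphism_action : automorphism_action le act.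
Proof.
split; [exact: coset_act1|exact: coset_actM| |].
  move=> g; split; first by exists (act^~ g^-1); [exact: coset_actK|exact: coset_actVK].
  move=> p q; split; first exact: coset_le_act.
  by move/(coset_le_act g^-1); rewrite !coset_actK.
(* Faithfulness: an element acting trivially fixes one flag, and [flag_of] is injective. *)
move=> g gE; have : flag_of (u0.1, u0.2 * g) = flag_of u0.
  rewrite -act_flag_of (_ : act^~ g = id) ?image_id //; exact/funext.
by move/flag_of_inj; case: u0 => x h /= [] /(canRL (mulKg h)); rewrite mulVg.
Qed.

(** * The symmetry type graph *)

Notation G := (range (fun g p => act p g)).

(** Flag orbits are the fibres of the derived graph over [X], by transitivity of [Gamma] on its
    second coordinate. *)
Lemma flag_orbitE u : flag_orbit G (flag_of u) = range (fun g => flag_of (u.1, g)).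
Proof.
apply/seteqP; split=> [_ [_ [g _ <-] <-]|_ [g _ <-]].
  by exists (u.2 * g) => //; rewrite -act_flag_of.
exists (act^~ (u.2^-1 * g)); first by exists (u.2^-1 * g).
by rewrite act_flag_of mulVKg.
Qed.

Lemma flag_orbit_eq u v :
  flag_orbit G (flag_of u) = flag_orbit G (flag_of v) <-> u.1 = v.1.
Proof.
rewrite !flag_orbitE; split=> [e|-> //].
have : range (fun g => flag_of (v.1, g)) (flag_of u).
  by rewrite -e; exists u.2 => //; case: u {e}.
by move=> [g _ /flag_of_inj <-].
Qed.

Notation T := (@symmetry_type_graph n poset le rk G).

Definition orbit_of x : vertex T :=
  exist _ _ (ex_intro2 _ _ (flag_of (x, 1))
    ((flag_ofP _).2 (ex_intro _ (x, 1) erefl)) erefl).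

Lemma orbit_ofE (O : vertex T) u :
  sval O = flag_orbit G (flag_of u) -> orbit_of u.1 = O.
Proof.
by case: O => O PO /= OE; apply: eq_exist; rewrite OE; exact/flag_orbit_eq.
Qed.

Lemma orbit_dart_proof d :
  is_stg_dart rk (orbit_of (src d), colour d, orbit_of (tgt d)).
Proof.
(* The ends of the lift [(d, 1)] of [d]. *)
exists (flag_of (src d, 1)), (flag_of (tgt d, xi d * 1)); split=> //=.
- by apply/flag_ofP; exists (src d, 1).
- by apply/flag_ofP; exists (tgt d, xi d * 1).
- by apply/flag_of_adjacent; rewrite neighbour_derived.
- by apply/flag_orbit_eq.
Qed.

Definition orbit_dart d : dart T := exist _ _ (orbit_dart_proof d).

Lemma orbit_of_inj : injective orbit_of.
Proof. by move=> x y /(congr1 sval) /flag_orbit_eq. Qed.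

Lemma orbit_of_bij : bijective orbit_of.
Proof.
rewrite -setTT_bijective; split=> //; first by move=> x y _ _; exact: orbit_of_inj.
move=> O _; have [P /flag_ofP[u PE] OP] := svalP O.
by exists u.1 => //; apply: orbit_ofE; rewrite OP PE.
Qed.

(** A dart of [X] is determined by its source and colour; conversely, adjacent flags come from [u]
    and [r i u], joined by the lift of a dart at [u.1]. *)
Lemma orbit_dart_bij : bijective orbit_dart.
Proof.
rewrite -setTT_bijective; split=> //.
  move=> d e _ _ /(congr1 sval)[/flag_orbit_eq/= sde cde _].
  by rewrite -(dart_atE one_dart d) -(dart_atE one_dart e) sde cde.
move=> [[[O i] O'] OO'] _; have [P [Q []]] := OO'.
move=> /flag_ofP[u ->] /flag_ofP[v ->] /= /flag_of_adjacent vE OP OQ.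
exists (dart_at one_dart u.1 i) => //; apply: eq_exist.
set d := dart_at _ _ _.
have [su ci] : src d = u.1 /\ colour d = i by rewrite src_dart_at colour_dart_at.
have tv : tgt d = v.1.
  by rewrite vE -ci (_ : u = (src d, u.2)) ?neighbour_derived // su; exact: surjective_pairing.
by rewrite su ci tv (orbit_ofE OP) (orbit_ofE OQ).
Qed.

Lemma symmetry_type_graph_isomorphic : cgraph_isomorphic X T.
Proof.
exists orbit_of, orbit_dart; split; [exact: orbit_of_bij|exact: orbit_dart_bij|].
move=> d; split=> //; apply: eq_exist => /=.
by rewrite src_dinv colour_dinv -[tgt (dinv d)]src_dinv dinvK.
Qed.

End CosetPoset.

(** * Deriving the hypotheses on the derived graph and concluding *)

Lemma cgraph_isomorphic_sym (n : nat) (X Y : cgraph n) :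
  cgraph_isomorphic X Y -> cgraph_isomorphic Y X.
Proof.
move=> [fV [fD [[gV fVK gVK] [gD fDK gDK] fE]]].
exists gV, gD; split; [by exists fV|by exists fD|move=> d].
have [sE tE iE cE] := fE (gD d); rewrite gDK in sE tE iE cE.
by split; rewrite ?cE // -?iE ?fDK // ?sE ?tE fVK.
Qed.

Theorem theorem4p4 (n : nat) (X : cgraph n) (Gamma : groupType)
    (xi : voltage X Gamma)
    (f : subgraph X -> vertex X) (W : vertex X -> 'I_n -> seq (dart X))
    (Xpremaniplex : premaniplex X)
    (f_choice : choice_function f)
    (W_base : base_paths f W)
    (derived_maniplex : maniplex (derived xi))
    (path_intersection : forall (k m : 'I_n) (x y : vertex X),
       voltages xi [set c : 'I_n | (0 <= c <= m)%N] x y `&`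
       voltages xi [set c : 'I_n | (k <= c <= n.-1)%N] x y =
       voltages xi [set c : 'I_n | (k <= c <= m)%N] x y) :
  [/\ polytope n (coset_le xi f W) (coset_rank xi f),
      automorphism_action (coset_le xi f W) (coset_act xi f)
    & cgraph_isomorphic
        (symmetry_type_graph (coset_le xi f W) (coset_rank xi f)
           (range (fun (g : Gamma) a => coset_act xi f a g)))
        X].
Proof.
have [_ _ one_dart _] := Xpremaniplex.
have [[_ [u0 _] d_conn] [d_loopless _] _ _ d_far] := derived_maniplex.
pose r := neighbour (@derived_one_dart _ _ _ xi one_dart).
have rC (i j : 'I_n) u : far i j -> r i (r j u) = r j (r i u).
  move=> ij; apply: neighbour_four_cycle; last exact: d_far.
  by move=> eij; move: ij; rewrite /far eij ltnNge leqnSn => -[].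
have r_neq i u : r i u <> u.
  move=> riu; apply: (d_loopless (dart_at (@derived_one_dart _ _ _ xi one_dart) u i)).
  by rewrite src_dart_at; exact/esym.
have link_all u v : link r setT u v.
  by have [//|//|p] := d_conn u v; exact: walk_on_link.
have link_interval (k m : nat) u v :
    link r [set c : 'I_n | c < m]%N u v -> link r [set c : 'I_n | k <= c]%N u v ->
    link r [set c : 'I_n | k <= c < m]%N u v.
  (* The given property has both bounds in ['I_n]. For [m = 0] or [n <= k] one path is empty; an
     upper bound beyond [n] imposes nothing. *)
  case: m => [|m] uv_m uv_k.
    by rewrite (link_none _ uv_m) //; exact: link_refl.
  case: (leqP n k) => [nk|kn].
    rewrite (link_none _ uv_k); first exact: link_refl.
    by move=> c /(leq_trans nk); rewrite leqNgt ltn_ord.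
  case: (leqP n m) => [nm|mn].
    apply: link_sub uv_k => c /= ->; apply: leq_trans (ltn_ord c) _; exact: ltnW.
  apply/link_derived.
  have := path_intersection (Ordinal kn) (Ordinal mn) u.1 v.1.
  move/seteqP => [+ _]; apply; split; apply/link_derived => //.
  apply: link_sub uv_k => c /= ->; rewrite -ltnS prednK ?ltn_ord //.
  exact: leq_ltn_trans (leq0n k) kn.
split.
- exact: coset_polytope W_base rC r_neq link_all link_interval u0.
- exact: coset_automorphism_action W_base rC link_all link_interval u0.
- apply: cgraph_isomorphic_sym.
  exact: symmetry_type_graph_isomorphic W_base rC r_neq link_all link_interval u0.
Qed.
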